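(* For all integers $n\ge1$ and $r,s,i,j\ge 1$, the following congruences hold: \begin{align*} \bar{a}_{r,s}(n)&\equiv 0 \pmod 2,\\ \bar{a}_{r,s}(4n+2)&\equiv 0\pmod 4, \quad\text{when } r+s \text{ is even},\\ \bar{a}_{2j,2i+1}(4n+3)&\equiv 0 \pmod 4,\\ \bar{a}_{r,2i}(3n+1)&\equiv 0 \pmod 4,\\ \bar{a}_{r,s}(3n+2)&\equiv 0 \pmod 4, \quad \text{when } r+s \text{ is even},\\ \bar{a}_{r,s}(9n+3)&\equiv 0 \pmod 4,\\ \bar{a}_{r,s}(9n+6)&\equiv 0 \pmod 4,\\ \bar{a}_{2j+1, s}(9n+3)&\equiv 0 \pmod 8,\\ \bar{a}_{2j+1, s}(9n+6)&\equiv 0 \pmod 8. \end{align*}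
   Context: For $m\ge1$ let $f_m:=\prod_{k=1}^{\infty}(1-q^{mk})$. For integers $r,s\ge1$, $\bar{a}_{r,s}(n)$ denotes the number of overpartitions of $n$ (partitions in which the first occurrence of each part size may be overlined) wherein each even part may appear in one of $r$ colors and each odd part in one of $s$ colors; its generating function is \[ \sum_{n=0}^{\infty}\bar{a}_{r,s}(n)q^n=\frac{f_2^{3s-2r}}{f_1^{2s}f_4^{s-r}}. \] *)

(* Defs.v *)
From mathcomp Require Import all_boot.

Set Implicit Arguments.
Unset Strict Implicit.
Unset Printing Implicit Defensive.

Definition ncolors (r s k : nat) : nat := if odd k then s else r.

(* Colored parts that can occur in an overpartition of n: the index k : 'I_n
   stands for the part size k.+1, so that sizes range over 1, ..., n; parts of
   the same size and of different colors are different parts. *)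
Definition cpart (r s n : nat) : finType :=
  {k : 'I_n & 'I_(ncolors r s k.+1)}.

Definition part_size (r s n : nat) (p : cpart r s n) : nat := (tag p).+1.

(* A colored overpartition of n is given by the multiplicity of every colored
   part (at most n, hence the codomain 'I_n.+1) and by the set of the colored
   parts whose first occurrence is overlined; such a part must occur. *)
Definition overpartitions (r s n : nat) :
    {set {ffun cpart r s n -> 'I_n.+1} * {set cpart r s n}} :=
  [set mo : {ffun cpart r s n -> 'I_n.+1} * {set cpart r s n} |
    (\sum_p mo.1 p * part_size p == n)
    && [forall p in mo.2, 0 < mo.1 p]].

Definition abar (r s n : nat) : nat := #|overpartitions r s n|.

(* Main.v *)
(** An overpartition is a multiplicity function together with a choice of
overlined parts in its support, so the number of overpartitions of [n] is the
coefficient of [X^n] in [\prod_p (1 + 2 u_p)], where [p] ranges over the colored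
parts and [u_p] is the sum of the [X^(j |p|)] for [j >= 1].  Modulo 8 this
product is [1 + 2 S + 4 E], where [S] and [E] are the first two elementary
symmetric functions of the [u_p].  The coefficient of [X^n] in [S] is
[D n = \sum_(d %| n) c_d], with [c_d] the number of colors of parts of size [d];
it is odd only if [n] is a square (and [s] is odd) or twice a square (and
[r + s] is odd), since the number of divisors of [n] is odd only for squares.
This gives the congruences modulo 2 and 4.
Modulo 8, [2 E = S^2 - \sum_p u_p^2] turns [D n + 2 E_n] into
[\sum_(d %| n) c_d (2 - n / d) + \sum_(0 < a < n) D a * D (n - a)].  When
[n = 3, 6 mod 9], pairing [d] with [3 d] makes the first sum divisible by 4.  In
the second one, [D a * D (n - a)] is even for odd [r]: [n] is neither a sum of
two squares nor twice such a sum, and [s (r + s)] is even. *)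

Require Import Defs.
From mathcomp Require Import all_boot.
From mathcomp Require Import all_algebra zify ring.

Import GRing.Theory.

(* [divisors 0] is [[:: 1]], so that the value at [a = 0] is [s], not [0]. *)
Definition divisor_colors (r s a : nat) : nat :=
  \sum_(d <- divisors a) ncolors r s d.

(** * Sums over divisors and the parity of [divisor_colors] *)

Lemma big_divisors_mul (R : nmodType) (p m : nat) (F : nat -> R) :
    prime p -> 0 < m ->
  (\sum_(d <- divisors (p * m)) F d =
   \sum_(d <- divisors (p * m) | ~~ (p %| d)%N) F d +
   \sum_(d <- divisors m) F (p * d))%R.
Proof.
move=> p_pr m_gt0; have p_gt0 := prime_gt0 p_pr.
rewrite (bigID (fun d => p %| d)) /= addrC; congr (_ + _)%R.
rewrite -(big_map (muln p) xpredT F) -big_filter; apply: perm_big.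
apply: uniq_perm.
- by rewrite filter_uniq // divisors_uniq.
- rewrite map_inj_uniq ?divisors_uniq // => x y /eqP.
  by rewrite eqn_pmul2l // => /eqP.
move=> d; rewrite mem_filter -dvdn_divisors ?muln_gt0 ?p_gt0 //.
apply/andP/mapP => [[/dvdnP[e ->]] | [e]].
  rewrite mulnC dvdn_pmul2l // => em; exists e => //.
  by rewrite -dvdn_divisors.
rewrite -dvdn_divisors // => em ->.
by rewrite dvdn_mulr // dvdn_pmul2l.
Qed.

Lemma big_divisors_mul3 (R : nmodType) (m : nat) (F : nat -> R) :
    0 < m -> ~~ (3 %| m) ->
  (\sum_(d <- divisors (3 * m)) F d =
   \sum_(d <- divisors m) (F d + F (3 * d)%N))%R.
Proof.
move=> m_gt0 m3; rewrite big_divisors_mul // big_split /=; congr (_ + _)%R.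
rewrite -big_filter; apply: perm_big; apply: uniq_perm.
- by rewrite filter_uniq // divisors_uniq.
- exact: divisors_uniq.
move=> d; rewrite mem_filter -!dvdn_divisors ?muln_gt0 //.
apply/andP/idP => [[d3]|dm].
  by rewrite Gauss_dvdr // coprime_sym prime_coprime.
split; last exact: dvdn_mull.
by apply: contra m3 => d3; apply: dvdn_trans d3 dm.
Qed.

(** Unless [a] is a square, the involution taking [d] to [a %/ d] has no fixed point and matches the
    divisors below the square root of [a] with those above it. *)
Lemma odd_num_divisors (a : nat) :
  odd (size (divisors a)) -> exists x, a = x ^ 2.
Proof.
case: (posnP a) => [->|a_gt0]; first by exists 0.
case: (boolP (has (fun d => d ^ 2 == a) (divisors a))) => [/hasP[d _ /eqP da] _|].
  by exists d; rewrite da.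
move/hasPn => nsq; rewrite -sum1_size.
rewrite (bigID (fun d => d ^ 2 < a)) /=.
suff ->: \sum_(i <- divisors a | ~~ (i ^ 2 < a)) 1 =
         \sum_(i <- divisors a | i ^ 2 < a) 1 by rewrite addnn odd_double.
have divK d : d \in divisors a -> d * (a %/ d) = a.
  by rewrite -dvdn_divisors // => da; rewrite mulnC divnK.
have div_div d : d \in divisors a -> a %/ d \in divisors a.
  by rewrite -!dvdn_divisors // => /divnK {2}<-; apply: dvdn_mulr.
have codivisors : perm_eq (divisors a) [seq a %/ d | d <- divisors a].
  apply: uniq_perm; rewrite ?divisors_uniq //.
    rewrite map_inj_in_uniq ?divisors_uniq // => x y /divK xE /divK yE e.
    move: yE; rewrite -e -{2}xE => /eqP; rewrite eqn_pmul2r; first by move/eqP.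
    by move: a_gt0; rewrite -{1}xE muln_gt0 => /andP[].
  move=> d; apply/idP/mapP => [da|[e ea ->]]; last exact: div_div.
  by exists (a %/ d); [exact: div_div | have := divK _ da; have := divK _ (div_div _ da); nia].
rewrite [RHS](perm_big _ codivisors) big_map big_seq_cond [RHS]big_seq_cond.
apply: eq_bigl => d; case: (boolP (d \in _)) => //= da.
have dE := divK d da; have := nsq d da; nia.
Qed.

(** Modulo 2, a part size [d] has [s] colors, plus [r + s] more when [d] is even. The even divisors
    of [2 * b] are the doubles of the divisors of [b], so both contributions reduce to numbers of
    divisors. *)
Lemma odd_divisor_colors (r s a : nat) : odd (divisor_colors r s a) ->
  (odd s /\ exists x, a = x ^ 2) \/ (odd (r + s) /\ exists x, a = 2 * x ^ 2).
Proof.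
case: (posnP a) => [->|a_gt0]; first by
  rewrite /divisor_colors (_ : divisors 0 = [:: 1]) // big_seq1; left;
  split=> //; exists 0.
have -> : odd (divisor_colors r s a) =
    odd (s * size (divisors a) + (r + s) * \sum_(d <- divisors a) ~~ odd d).
  rewrite /divisor_colors -sum1_size !big_distrr -big_split /=.
  elim: (divisors a) => [|d l IH]; first by rewrite !big_nil.
  rewrite !big_cons !oddD IH; congr (_ (+) _); rewrite /ncolors.
  by case: (odd d); lia.
have Hodd : odd (\sum_(d <- divisors a) ~~ odd d) -> exists x, a = 2 * x ^ 2.
  case: (boolP (odd a)) => [aodd|aev].
    rewrite big_seq big1 // => d; rewrite -dvdn_divisors // => /dvdn_odd.
    by move=> /(_ aodd) ->.
  have [b bE] : exists b, a = 2 * b by exists a./2; lia.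
  rewrite bE in a_gt0 *; rewrite big_divisors_mul //; last by lia.
  rewrite big1; last by move=> d; rewrite dvdn2 negbK => ->.
  rewrite add0r (eq_bigr (fun=> 1)); last by move=> d _; rewrite oddM.
  by rewrite -[X in odd X]/(\sum_(d <- divisors b) 1)%N sum1_size => /odd_num_divisors[x ->]; exists x.
rewrite oddD !oddM.
case: (boolP (odd s)) => [sodd|_] /=.
  case: (boolP (odd (size _))) => [/odd_num_divisors|_] /=; first by left.
  by case/andP => rs /Hodd; right.
by case/andP => rs /Hodd; right.
Qed.

(** * Truncated generating functions and their coefficients *)

Local Open Scope ring_scope.

(* Agrees with [X^d / (1 - X^d)] only up to degree [n]. *)
Definition part_poly (n d : nat) : {poly int} :=
  \sum_(1 <= j < n.+1) 'X^(j * d).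

Lemma coef_part_poly (n d a : nat) : (0 < d)%N -> (a <= n)%N ->
  (part_poly n d)`_a = ((0 < a) && (d %| a))%N%:Z.
Proof.
move=> d_gt0 an; rewrite /part_poly coef_sum.
under eq_bigr do rewrite coefXn.
case: (boolP (_ && _)) => [/andP[a_gt0 /dvdnP[k aE]]|H].
  rewrite (bigD1_seq k) ?iota_uniq //=; last first.
    by rewrite mem_index_iota; nia.
  rewrite aE eqxx big1 ?addr0 // => i ik.
  by rewrite eqn_pmul2r // eq_sym (negPf ik).
rewrite big_nat big1 // => k /andP[k_gt0 _].
case: eqP => // aE; move: H; rewrite aE dvdn_mull // andbT muln_gt0.
by rewrite k_gt0 d_gt0.
Qed.

Lemma coef_part_poly_sqr (n d : nat) : (0 < n)%N -> (0 < d)%N ->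
  (part_poly n d ^+ 2)`_n = ((d %| n) * (n %/ d).-1)%N%:Z.
Proof.
move=> n_gt0 d_gt0; rewrite expr2 coefM.
transitivity (\sum_(1 <= a < n) ((d %| n) * (d %| a))%N%:Z : int).
  rewrite -(big_mkord xpredT (fun a => (part_poly n d)`_a * (part_poly n d)`_(n - a))).
  rewrite big_nat_recr //= subnn coef_part_poly // [X in _ * X]coef_part_poly //= mulr0 addr0.
  rewrite big_ltn // coef_part_poly //= mul0r add0r.
  apply: eq_big_nat => a /andP[a1 an].
  rewrite !coef_part_poly ?leq_subr //; last exact: ltnW.
  rewrite a1 subn_gt0 an /= -PoszM mulnb mulnb andbC.
  case: (boolP (d %| a)%N) => da; last by rewrite !andbF.
  by rewrite !andbT dvdn_subl // ltnW.
rewrite -(big_morph Posz PoszD (erefl _)) -big_distrr /=.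
case: (boolP (d %| n)%N) => [dn|]; last by rewrite !mul0n.
(* Among 1, ..., [n] there are [n %/ d] multiples of [d]; the sum omits [n] itself, hence the
   predecessor. *)
by rewrite divn_count_dvd big_nat_recr //= dn addn1.
Qed.

(** The bound [a <= n] makes every divisor of [a] an available part size, met once per color. *)
Lemma big_cpart (r s n a : nat) (F : nat -> nat) : (0 < a <= n)%N ->
  (\sum_(p : cpart r s n) (part_size p %| a) * F (part_size p) =
   \sum_(d <- divisors a) F d * ncolors r s d)%N.
Proof.
case/andP => a_gt0 an.
transitivity (\sum_(k < n) \sum_(c < ncolors r s k.+1) (k.+1 %| a) * F k.+1)%N.
  by rewrite sig_big_dep.
transitivity (\sum_(1 <= d < n.+1 | (d %| a)%N) F d * ncolors r s d)%N.
  rewrite big_add1 [RHS]big_mkcond big_mkord; apply: eq_bigr => k _.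
  rewrite sum_nat_const card_ord mulnC.
  by case: ifP => _; rewrite ?mul1n ?mul0n.
rewrite -big_filter; apply: perm_big; apply: uniq_perm.
- by rewrite filter_uniq // iota_uniq.
- exact: divisors_uniq.
move=> d; rewrite mem_filter mem_index_iota -dvdn_divisors // andbC.
case: (boolP (d %| a)%N) => da; last by rewrite andbF.
by rewrite andbT (dvdn_gt0 a_gt0 da) ltnS (leq_trans (dvdn_leq a_gt0 da) an).
Qed.

Lemma coef_sum_part_poly (r s n a : nat) : (a <= n)%N ->
  (\sum_(p : cpart r s n) part_poly n (part_size p))`_a =
  ((0 < a) * divisor_colors r s a)%N%:Z.
Proof.
move=> an; rewrite coef_sum.
under eq_bigr do rewrite coef_part_poly //.
rewrite -(big_morph Posz PoszD (erefl _)); congr Posz.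
case: (posnP a) => [_|a_gt0]; first by rewrite big1.
rewrite mul1n /divisor_colors; under [RHS]eq_bigr do rewrite -[ncolors _ _ _]mul1n.
rewrite -(big_cpart _ _ n _ (fun=> 1%N)) ?a_gt0 //.
by apply: eq_bigr => p _; rewrite muln1.
Qed.

Lemma coef_sum_part_poly_sqr (r s n : nat) : (0 < n)%N ->
  (\sum_(p : cpart r s n) part_poly n (part_size p) ^+ 2)`_n =
  (\sum_(d <- divisors n) (n %/ d).-1 * ncolors r s d)%N%:Z.
Proof.
move=> n_gt0; rewrite coef_sum.
under [LHS]eq_bigr do rewrite coef_part_poly_sqr //.
rewrite -(big_morph Posz PoszD (erefl _)); congr Posz.
by rewrite (big_cpart _ _ _ _ (fun d => (n %/ d).-1)) ?n_gt0 /=.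
Qed.

Lemma abar_coef (r s n : nat) :
  (abar r s n)%:Z =
  (\prod_(p : cpart r s n) (1 + 2%:R * part_poly n (part_size p)))`_n.
Proof.
pose w (j : nat) : nat := if j == 0%N then 1%N else 2%N.
have -> : \prod_(p : cpart r s n) (1 + 2%:R * part_poly n (part_size p)) =
    \prod_(p : cpart r s n) \sum_(j < n.+1) 'X^(j * part_size p) *+ w j
      :> {poly int}.
  apply: eq_bigr => p _.
  rewrite big_ord_recl mul0n expr0; congr (_ + _).
  rewrite /part_poly big_add1 big_mkord mulr_sumr; apply: eq_bigr => j _.
  by rewrite mulr_natl.
rewrite bigA_distr_bigA coef_sum.
have -> : abar r s n = (\sum_(f : {ffun cpart r s n -> 'I_n.+1})
    (n == \sum_p f p * part_size p) * \prod_p w (f p))%N.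
  rewrite /abar /overpartitions -sum1dep_card big_mkcond.
  rewrite -(pair_bigA _ (fun (f : {ffun cpart r s n -> 'I_n.+1}) (A : {set _}) =>
    if (\sum_p f p * part_size p == n)%N && [forall p in A, 0 < f p]%N
    then 1%N else 0%N)) /=.
  apply: eq_bigr => f _; rewrite eq_sym; case: eqP => _ /=; last by rewrite big1.
  rewrite -big_mkcond mul1n sum1dep_card.
  (* The weights multiply to 2 to the size of the support of [f], and the admissible overlined sets
     are the subsets of this support. *)
  transitivity (2 ^ #|[set p | 0 < f p]|)%N; last first.
    rewrite -prod_nat_const [LHS]big_mkcond; apply: eq_bigr => p _.
    by rewrite inE lt0n /w; case: eqP.
  rewrite -card_powerset; apply: eq_card => A; rewrite !inE.
  apply/forall_inP/subsetP => H p pA; first by rewrite inE H.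
  by have := H p pA; rewrite inE.
rewrite (big_morph Posz PoszD (erefl _)); apply: eq_bigr => f _.
rewrite prodrMn prodrXr coefMn coefXn PoszM natz.
by rewrite -mulr_natr natz.
Qed.

Lemma prod_1D2 (R : comPzRingType) (I : Type) (l : seq I) (u : I -> R) :
  exists E Q : R,
    \prod_(i <- l) (1 + 2%:R * u i) =
      1 + 2%:R * \sum_(i <- l) u i + 4%:R * E + 8%:R * Q /\
    (\sum_(i <- l) u i) ^+ 2 = \sum_(i <- l) u i ^+ 2 + 2%:R * E.
Proof.
elim: l => [|i l [E [Q [IH1 IH2]]]].
  by exists 0, 0; rewrite !big_nil; split; ring.
(* [E] follows the recursion of the second elementary symmetric function; [Q] absorbs the terms with
   a factor 8. *)
exists (E + u i * \sum_(j <- l) u j), (Q + u i * E + 2%:R * u i * Q).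
rewrite !big_cons IH1; split; first by ring.
by rewrite sqrrD IH2; ring.
Qed.

Lemma abar_expansion (r s n : nat) : (0 < n)%N ->
  exists E Q : int,
    (abar r s n)%:Z = 2 * (divisor_colors r s n)%:Z + 4 * E + 8 * Q /\
    2 * E + (\sum_(d <- divisors n) (n %/ d).-1 * ncolors r s d)%N%:Z =
    (\sum_(1 <= a < n) divisor_colors r s a * divisor_colors r s (n - a))%N%:Z.
Proof.
move=> n_gt0.
have [/= E [/= Q [H1 H2]]] := prod_1D2 {poly int} _ (index_enum (cpart r s n))
  (fun p => part_poly n (part_size p)).
have an_le (a : 'I_n.+1) : (a <= n)%N by rewrite -ltnS.
exists E`_n, Q`_n; split.
  rewrite abar_coef H1 !(mulr_natl (_ : {poly int})) !coefD coef1 !coef_sum_part_poly //.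
  by rewrite n_gt0 mul1n eqn0Ngt n_gt0 /=; ring.
move/(congr1 (fun P : {poly int} => P`_n)): H2.
rewrite expr2 coefM mulr_natl !coefD coef_sum_part_poly_sqr // => H2.
rewrite mulr_natl addrC -{}H2.
under [LHS]eq_bigr do rewrite !coef_sum_part_poly ?leq_subr // -PoszM.
rewrite -(big_morph Posz PoszD (erefl _)); congr Posz.
(* The factor [0 < a] cancels the default value of [divisor_colors] at 0, so both end terms of the
   Cauchy product vanish. *)
pose D a := ((0 < a) * divisor_colors r s a)%N.
rewrite -(big_mkord xpredT (fun a => D a * D (n - a))%N).
rewrite big_nat_recr //= subnn muln0 addn0 big_ltn // add0n.
by apply: eq_big_nat => a /andP[a1 an]; rewrite /D a1 subn_gt0 an !mul1n.
Qed.

Local Close Scope ring_scope.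

(** * Residues of squares, and the congruences modulo 4 and 8 *)

Lemma sqr_mod3 (x : nat) : x ^ 2 %% 3 = (x %% 3 != 0).
Proof. by rewrite -modnXm; case: (x %% 3) (ltn_pmod x (isT : 0 < 3)) => [|[|[|]]]. Qed.

Lemma sqr_mod9 (x : nat) : x ^ 2 %% 3 = 0 -> x ^ 2 %% 9 = 0.
Proof.
rewrite sqr_mod3; case: eqP => // /eqP /dvdnP[y ->] _.
by rewrite expnMn modnMl.
Qed.

Lemma sqr_mod4 (x : nat) : x ^ 2 %% 4 = odd x.
Proof.
rewrite -modnXm -(odd_mod x (erefl : odd 4 = false)).
by case: (x %% 4) (ltn_pmod x (isT : 0 < 4)) => [|[|[|[|]]]].
Qed.

Lemma abar_mod4 (r s n : nat) : 0 < n -> ~~ odd (divisor_colors r s n) ->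
  abar r s n = 0 %[mod 4].
Proof.
move=> n_gt0 Dev; have [E [Q [H _]]] := abar_expansion r s n n_gt0.
lia.
Qed.

(* Modulo 4, [1 + 3 (n / d - 1)] is the coefficient [2 - n / d] of [c_d]. *)
Lemma divisor_colors_mul3 (r s m : nat) : 0 < m -> ~~ (3 %| m) ->
  divisor_colors r s (3 * m) +
    3 * (\sum_(d <- divisors (3 * m)) (3 * m %/ d).-1 * ncolors r s d)
  = 0 %[mod 4].
Proof.
move=> m_gt0 m3; rewrite /divisor_colors big_distrr -big_split /=.
rewrite (big_divisors_mul3 nat) //; apply/eqP; rewrite mod0n.
rewrite big_seq; apply: (big_ind (fun x => 4 %| x)) => //.
  by move=> x y; apply: dvdn_add.
move=> d dm; have dE : d %| m by rewrite dvdn_divisors.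
have d_gt0 := dvdn_gt0 m_gt0 dE.
have -> : ncolors r s (3 * d) = ncolors r s d by rewrite /ncolors oddM.
rewrite divnMl // -muln_divA //.
have : 0 < m %/ d by rewrite divn_gt0 // dvdn_leq.
move: (m %/ d) (ncolors r s d) => [//|e] c _.
(* With [m %/ d = e + 1], the pair contributes [c * (1 + 3 * (3 * e + 2)) + c * (1 + 3 * e)]. *)
apply/dvdnP; exists (c * (3 * e + 2)).
rewrite /GRing.add /=; nia.
Qed.

(** Exchanging [a] and [n - a] shows that the terms off the middle add up to twice an even sum; only
    a middle term must itself be divisible by 4. *)
Lemma dvdn4_symmetric_sum (n : nat) (F : nat -> nat) :
    (forall a, 0 < a < n -> 2 %| F a) ->
    (forall a, 0 < a < n -> F (n - a) = F a) ->
    (forall a, n = a.*2 -> 4 %| F a) ->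
  4 %| \sum_(1 <= a < n) F a.
Proof.
move=> F2 Fsym Fmid.
rewrite (bigID (fun a => a.*2 < n)) /=.
rewrite [X in _ + X](bigID (fun a => a.*2 == n)) /=.
rewrite addnCA dvdn_addr; last first.
  by apply: dvdn_sum => a /andP[_ /eqP aE]; apply: Fmid.
have -> : \sum_(1 <= a < n | ~~ (a.*2 < n) && (a.*2 != n)) F a =
          \sum_(1 <= a < n | a.*2 < n) F a.
  rewrite big_nat_rev /= big_nat_cond [RHS]big_nat_cond.
  apply: eq_big => a; first by apply/idP/idP; lia.
  by case/andP => an _; rewrite add1n subSS Fsym.
suff : 2 %| \sum_(1 <= a < n | a.*2 < n) F a by lia.
rewrite big_nat_cond; apply: dvdn_sum => a /andP[an _]; exact: F2.
Qed.

(** Here 3 divides [n] exactly once, but if it divides a square or twice a square, so does 9. *)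
Lemma odd_divisor_colors_3adic (r s n : nat) :
  n %% 9 \in [:: 3; 6] -> ~~ odd (divisor_colors r s n).
Proof.
move=> n9; apply/negP => /odd_divisor_colors.
have n3 x : 3 %| x ^ 2 -> n != x ^ 2 /\ n != 2 * x ^ 2.
  move=> /eqP/sqr_mod9 x9.
  by split; apply: contraTneq n9 => ->; rewrite ?x9 // -modnMmr x9.
case=> [[_ [x nE]]|[_ [x nE]]].
  have [] := n3 x; last by rewrite nE eqxx.
  by move: n9; rewrite -nE !inE; lia.
have [] := n3 x; last by rewrite nE eqxx.
by move: n9; rewrite !inE; lia.
Qed.

(** For odd [r] exactly one of [s] and [r + s] is odd, so two odd factors would make [a] and [n - a]
    both squares or both twice squares. But 9 divides any sum of two squares that 3 divides. *)
Lemma divisor_colors_convolution_even (r s n a : nat) : odd r ->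
    n %% 9 \in [:: 3; 6] -> 0 < a < n ->
  2 %| divisor_colors r s a * divisor_colors r s (n - a).
Proof.
move=> rodd n9 /andP[a_gt0 an]; rewrite dvdn2 oddM; apply/negP => /andP[].
have nE : n = a + (n - a) by lia.
move: (n - a) nE {an} => b nE.
have noSqr k x y : n = k * (x ^ 2 + y ^ 2) -> k \in [:: 1; 2] -> False.
  move=> nkE k12.
  have : (x ^ 2 %% 3 = 0) /\ (y ^ 2 %% 3 = 0).
    have := sqr_mod3 x; have := sqr_mod3 y; move: n9 k12; rewrite !inE; lia.
  case=> /sqr_mod9 x9 /sqr_mod9 y9.
  by move: n9 k12; rewrite !inE; lia.
move=> /odd_divisor_colors Ha /odd_divisor_colors Hb.
case: Ha Hb => [[so [x aE]]|[so [x aE]]] [[so' [y bE]]|[so' [y bE]]].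
- by apply: (noSqr 1 x y) => //; lia.
- by move: so'; rewrite oddD rodd so.
- by move: so; rewrite oddD rodd so'.
- by apply: (noSqr 2 x y) => //; lia.
Qed.

Lemma abar_mod8 (r s n : nat) : odd r -> n %% 9 \in [:: 3; 6] ->
  abar r s n = 0 %[mod 8].
Proof.
move=> rodd n9.
have [m nE] : exists m, n = 3 * m by exists (n %/ 3); move: n9; rewrite !inE; lia.
have m3 : ~~ (3 %| m) by move: n9; rewrite !inE; lia.
have m_gt0 : 0 < m by case: m m3 {nE}.
have n_gt0 : 0 < n by lia.
have [E [Q [H1 H2]]] := abar_expansion r s n n_gt0.
have := divisor_colors_mul3 r s m m_gt0 m3; rewrite -nE.
have : 4 %| \sum_(1 <= a < n) divisor_colors r s a * divisor_colors r s (n - a).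
  apply: dvdn4_symmetric_sum => a.
  - exact: divisor_colors_convolution_even.
  - by case/andP => _ an; rewrite subKn 1?mulnC // ltnW.
  (* In the middle the product is the square of a number, which is even because the product is. *)
  - move=> naE; have -> : n - a = a by lia.
    have := divisor_colors_convolution_even r s n a rodd n9.
    have -> : n - a = a by lia.
    rewrite dvdn2 oddM andbb => /(_ ltac:(lia)); rewrite -dvdn2 => D2.
    exact: (@dvdn_mul 2 2).
move: (\sum_(_ <= _ < _) _) (\sum_(_ <- _) _) (divisor_colors r s n) H1 H2.
(* Modulo 4, [2 * E = C - T] gives [D + 2 * E = D + 3 * T = 0]; modulo 8, [abar] is twice
   [D + 2 * E]. *)
move=> C T D H1 H2 C4 DT; lia.
Qed.

Theorem theorem1p5 (n r s i j : nat)
    (hn : 1 <= n) (hr : 1 <= r) (hs : 1 <= s) (hi : 1 <= i) (hj : 1 <= j) :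
  (abar r s n = 0 %[mod 2]) /\
  (~~ odd (r + s) -> abar r s (4 * n + 2) = 0 %[mod 4]) /\
  (abar (2 * j) (2 * i + 1) (4 * n + 3) = 0 %[mod 4]) /\
  (abar r (2 * i) (3 * n + 1) = 0 %[mod 4]) /\
  (~~ odd (r + s) -> abar r s (3 * n + 2) = 0 %[mod 4]) /\
  (abar r s (9 * n + 3) = 0 %[mod 4]) /\
  (abar r s (9 * n + 6) = 0 %[mod 4]) /\
  (abar (2 * j + 1) s (9 * n + 3) = 0 %[mod 8]) /\
  (abar (2 * j + 1) s (9 * n + 6) = 0 %[mod 8]).
Proof.
split; first by have [E [Q [H _]]] := abar_expansion r s n hn; lia.
(* In the next four claims, whichever of the forms [x ^ 2] and [2 * x ^ 2] the parities of the color
   numbers allow is excluded by residues modulo 4 or 3. *)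
split.
  move=> rs; apply: abar_mod4; first by lia.
  apply/negP => /odd_divisor_colors[[_ [x nE]]|[]]; last by rewrite (negPf rs).
  by have := sqr_mod4 x; rewrite -nE; lia.
split.
  apply: abar_mod4; first by lia.
  apply/negP => /odd_divisor_colors[[_ [x nE]]|[_ [x nE]]].
    by have := sqr_mod4 x; rewrite -nE; lia.
  by lia.
split.
  apply: abar_mod4; first by lia.
  apply/negP => /odd_divisor_colors[[]|[_ [x nE]]]; first by rewrite oddM.
  by have := sqr_mod3 x; lia.
split.
  move=> rs; apply: abar_mod4; first by lia.
  apply/negP => /odd_divisor_colors[[_ [x nE]]|[]]; last by rewrite (negPf rs).
  by have := sqr_mod3 x; rewrite -nE; lia.
have n3 : (9 * n + 3) %% 9 \in [:: 3; 6] by rewrite mulnC modnMDl.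
have n6 : (9 * n + 6) %% 9 \in [:: 3; 6] by rewrite mulnC modnMDl.
have jodd : odd (2 * j + 1) by rewrite oddD oddM.
split; first by apply: abar_mod4; [lia | exact: odd_divisor_colors_3adic].
split; first by apply: abar_mod4; [lia | exact: odd_divisor_colors_3adic].
by split; apply: abar_mod8.
Qed.
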